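(* Let $(Y, \rho)$ be a metric space whose generalized roundness $\wp$ is finite. Let $(X,d)$ be a metric space that has strict $q$-negative type for some $q \geq \wp$. Then $(X,d)$ is not isometric to any metric subspace of $(Y, \rho)$ that admits a non-trivial $p$-polygonal equality for some $p$ such that $\wp \leq p \leq q$.
   Context: Let $p\ge 0$ and let $(X,d)$ be a metric space (for $p=0$ the convention is $d(x,y)^0=1$ if $x\ne y$ and $d(x,x)^0=0$). $(X,d)$ has $p$-negative type if for all finite sets of distinct points $\{z_1,\ldots,z_n\}\subseteq X$ and all real $\alpha_1,\ldots,\alpha_n$ with $\alpha_1+\cdots+\alpha_n=0$ we have $\sum_{j,i=1}^n d(z_j,z_i)^p\alpha_j\alpha_i\le 0$; it has strict $p$-negative type if moreover this inequality is strict unless $\alpha_1=\cdots=\alpha_n=0$. The generalized roundness of $(X,d)$ is $\wp(X)=\sup\{q : (X,d)\text{ has }q\text{-negative type}\}$. A signed $(s,t)$-simplex in $X$ ($s,t>0$ integers) is a collection of (not necessarily distinct) points $x_{1},\ldots,x_{s},y_{1},\ldots,y_{t}\in X$ together with real numbers $m_{1},\ldots,m_{s},n_{1},\ldots,n_{t}$ satisfying $m_{1}+\cdots+m_{s}=n_{1}+\cdots+n_{t}$; it is denoted $D=[x_{j}(m_{j});y_{i}(n_{i})]_{s,t}$. Let $S(D)=\{x_1,\ldots,x_s\}\cup\{y_1,\ldots,y_t\}$. For $z\in S(D)$ put $\mathbf{m}(z)=\sum_{j:x_j=z}m_j$ and $\mathbf{n}(z)=\sum_{i:y_i=z}n_i$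 (empty sums are $0$). $D$ is degenerate if $\mathbf{m}(z)=\mathbf{n}(z)$ for all $z\in S(D)$. The $p$-simplex gap of $D$ is $$\gamma_{p}(D) = \sum_{j=1}^{s}\sum_{i=1}^{t} m_{j}n_{i}d(x_{j},y_{i})^{p} - \sum_{j_{1} < j_{2}} m_{j_{1}}m_{j_{2}}d(x_{j_{1}},x_{j_{2}})^{p} - \sum_{i_{1} < i_{2}} n_{i_{1}}n_{i_{2}}d(y_{i_{1}},y_{i_{2}})^{p}.$$ A metric space admits a non-trivial $p$-polygonal equality if there is a non-degenerate signed simplex $D$ in it with $\gamma_p(D)=0$. *)

(* Defs.v *)
From HB Require Import structures.
From mathcomp Require Import all_boot all_order all_algebra.
From mathcomp Require Import all_classical all_reals all_analysis.

Set Implicit Arguments.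
Unset Strict Implicit.
Unset Printing Implicit Defensive.

Import Order.TTheory GRing.Theory Num.Theory.

Local Open Scope classical_set_scope.
Local Open Scope ring_scope.

Lemma set_type_mdist_ge0 (R : realType) (Y : metricType R) (Z : set Y)
  (x y : Z) : 0 <= mdist (\val x) (\val y).
Proof. exact: mdist_ge0. Qed.

Lemma set_type_mdist_positivity (R : realType) (Y : metricType R) (Z : set Y)
  (x y : Z) : mdist (\val x) (\val y) = 0 -> x = y.
Proof. by move=> /mdist_positivity/val_inj. Qed.

Lemma set_type_ballEmdist (R : realType) (Y : metricType R) (Z : set Y)
  (x : Z) (d : R) : ball x d = [set y | mdist (\val x) (\val y) < d].
Proof.
by apply/seteqP; split => y /=; rewrite /ball/= /initial_ball ballEmdist.
Qed.

(* The metric subspace Z of Y: mathcomp-analysis already equips set_type Z with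
   the induced pseudometric structure; its distance is the restriction of that
   of Y. *)
HB.instance Definition _ (R : realType) (Y : metricType R) (Z : set Y) :=
  @PseudoMetric_isMetric.Build R (set_type Z)
    (fun x y : Z => mdist (\val x) (\val y))
    (@set_type_mdist_ge0 R Y Z) (@set_type_mdist_positivity R Y Z)
    (@set_type_ballEmdist R Y Z).

Definition isometric (R : realType) (X Y : metricType R) : Prop :=
  exists f : X -> Y,
    bijective f /\ forall x y : X, mdist (f x) (f y) = mdist x y.

(* d(x, y)^p for p >= 0.  The case p = 0 is separate because 0 `^ 0 = 1,
   whereas the convention here is d(x, x)^0 = 0. *)
Definition mdist_pow (R : realType) (X : metricType R) (p : R) (x y : X) : R :=
  if p == 0 then (x != y)%:R else mdist x y `^ p.

Definition negative_type (R : realType) (X : metricType R) (p : R) : Prop :=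
  forall (n : nat) (z : 'I_n -> X) (a : 'I_n -> R),
    injective z -> \sum_(i < n) a i = 0 ->
    \sum_(j < n) \sum_(i < n) mdist_pow p (z j) (z i) * a j * a i <= 0.

Definition strict_negative_type (R : realType) (X : metricType R) (p : R)
    : Prop :=
  negative_type X p /\
  forall (n : nat) (z : 'I_n -> X) (a : 'I_n -> R),
    injective z -> \sum_(i < n) a i = 0 ->
    ~ (forall i, a i = 0) ->
    \sum_(j < n) \sum_(i < n) mdist_pow p (z j) (z i) * a j * a i < 0.

Definition generalized_roundness (R : realType) (X : metricType R) : \bar R :=
  ereal_sup [set q%:E | q in [set q : R | 0 <= q /\ negative_type X q]].

Record signed_simplex (R : realType) (X : metricType R) := SignedSimplex {
  ss_s : nat;
  ss_t : nat;
  ss_s_gt0 : (0 < ss_s)%N;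
  ss_t_gt0 : (0 < ss_t)%N;
  ss_x : 'I_ss_s -> X;
  ss_y : 'I_ss_t -> X;
  ss_m : 'I_ss_s -> R;
  ss_n : 'I_ss_t -> R;
  ss_balance : \sum_(j < ss_s) ss_m j = \sum_(i < ss_t) ss_n i
}.

Definition ss_support (R : realType) (X : metricType R)
    (D : signed_simplex X) : set X :=
  range (@ss_x R X D) `|` range (@ss_y R X D).

Definition x_weight (R : realType) (X : metricType R)
    (D : signed_simplex X) (z : X) : R :=
  \sum_(j < ss_s D | ss_x j == z) ss_m j.

Definition y_weight (R : realType) (X : metricType R)
    (D : signed_simplex X) (z : X) : R :=
  \sum_(i < ss_t D | ss_y i == z) ss_n i.

Definition degenerate (R : realType) (X : metricType R)
    (D : signed_simplex X) : Prop :=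
  forall z : X, ss_support D z -> x_weight D z = y_weight D z.

Definition simplex_gap (R : realType) (X : metricType R) (p : R)
    (D : signed_simplex X) : R :=
  \sum_(j < ss_s D) \sum_(i < ss_t D)
      ss_m j * ss_n i * mdist_pow p (ss_x j) (ss_y i)
  - \sum_(j1 < ss_s D) \sum_(j2 < ss_s D | (j1 < j2)%N)
      ss_m j1 * ss_m j2 * mdist_pow p (ss_x j1) (ss_x j2)
  - \sum_(i1 < ss_t D) \sum_(i2 < ss_t D | (i1 < i2)%N)
      ss_n i1 * ss_n i2 * mdist_pow p (ss_y i1) (ss_y i2).

Definition nontrivial_polygonal_equality (R : realType) (X : metricType R)
    (p : R) : Prop :=
  exists D : signed_simplex X, ~ degenerate D /\ simplex_gap p D = 0.

(* Main.v *)
Require Import Defs.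
From HB Require Import structures.
From mathcomp Require Import all_boot all_order all_algebra.
From mathcomp Require Import all_classical all_reals all_analysis.
From mathcomp Require Import measurable_realfun ring lra.

(* Strict q-negative type passes down to every p with 0 <= p <= q.  For
   0 < p < q put K = d^q and alpha = p/q.  By Schoenberg the kernels exp(-tK)
   are positive semidefinite, and
     x^alpha * c = \int_R exp(-alpha v) (1 - exp(-e^v x)) dv
   by translating v by ln x, so for weights a of sum zero the form of K^alpha
   at a is a negative multiple of the integral of
   exp(-alpha v) <a, exp(-e^v K) a>.  This integrand is nonnegative, and bounded
   away from 0 on an interval because exp(-tK) tends to the identity as
   t -> +oo.
   Collecting the weights m - n of a simplex D on its distinct points gives a
   zero-sum family whose form is -2 gamma_p(D), so strict p-negative type forces
   gamma_p(D) > 0 for nondegenerate D. *)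

Set Implicit Arguments.
Unset Strict Implicit.
Unset Printing Implicit Defensive.

Import Order.TTheory GRing.Theory Num.Theory.
Import numFieldNormedType.Exports.

Local Open Scope classical_set_scope.
Local Open Scope ring_scope.

(** * Positive semidefinite kernels *)

Definition quad (R : realType) (I : finType) (M : I -> I -> R) (a : I -> R)
    : R :=
  \sum_i \sum_j M i j * a i * a j.

Definition psd (R : realType) (I : finType) (M : I -> I -> R) : Prop :=
  forall a, 0 <= quad M a.

Section psd_theory.
Context {R : realType} {I : finType}.
Implicit Types (M : I -> I -> R) (a b : I -> R).

Lemma eq_quad M N a : (forall i j, M i j = N i j) -> quad M a = quad N a.
Proof.
by move=> MN; apply: eq_bigr => i _; apply: eq_bigr => j _; rewrite MN.
Qed.

Lemma quad_rank1 (c a : I -> R) :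
  quad (fun i j => c i * c j) a = (\sum_i c i * a i) ^+ 2.
Proof.
rewrite expr2 mulr_suml; apply: eq_bigr => i _; rewrite mulr_sumr.
by apply: eq_bigr => j _; ring.
Qed.

Lemma quad_sum (T : Type) (s : seq T) (P : pred T) (M : T -> I -> I -> R) a :
  quad (fun i j => \sum_(k <- s | P k) M k i j) a =
  \sum_(k <- s | P k) quad (M k) a.
Proof.
rewrite /quad [RHS]exchange_big; apply: eq_bigr => i _.
rewrite exchange_big; apply: eq_bigr => j _.
by rewrite -mulrA mulr_suml; apply: eq_bigr => k _; rewrite mulrA.
Qed.

Lemma quadZ (k : R) M a : quad (fun i j => k * M i j) a = k * quad M a.
Proof.
rewrite /quad mulr_sumr; apply: eq_bigr => i _; rewrite mulr_sumr.
by apply: eq_bigr => j _; ring.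
Qed.

Lemma quad_scale (c : I -> R) M a :
  quad (fun i j => c i * c j * M i j) a = quad M (fun i => c i * a i).
Proof. by apply: eq_bigr => i _; apply: eq_bigr => j _; ring. Qed.

Lemma quadB M N a :
  quad (fun i j => M i j - N i j) a = quad M a - quad N a.
Proof.
rewrite /quad -sumrB; apply: eq_bigr => i _; rewrite -sumrB.
by apply: eq_bigr => j _; ring.
Qed.

Lemma sum_delta (F : I -> R) k : \sum_j F j * (j == k)%:R = F k.
Proof.
rewrite (bigD1 k)//= eqxx mulr1 big1 ?addr0// => j /negPf ->.
by rewrite mulr0.
Qed.

Lemma quad_delta M k : quad M (fun j => (j == k)%:R) = M k k.
Proof.
by rewrite /quad; under eq_bigr do rewrite sum_delta; rewrite sum_delta.
Qed.

(** Changing one coordinate of the argument serves twice: to complete the square in a Schur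
    complement, and to correct a vector to total weight zero. *)
Lemma quad_shift M a k (x : R) : (forall i j, M i j = M j i) ->
  quad M (fun i => a i + x * (i == k)%:R) =
  quad M a + 2 * x * (\sum_j M k j * a j) + x ^+ 2 * M k k.
Proof.
move=> Msym.
transitivity (\sum_i \sum_j (M i j * a i * a j +
    (x * (M i j * a i)) * (j == k)%:R + (x * (M i j * a j)) * (i == k)%:R +
    (x ^+ 2 * M i j * (i == k)%:R) * (j == k)%:R)).
  by apply: eq_bigr => i _; apply: eq_bigr => j _; ring.
under eq_bigr do rewrite !big_split/= !sum_delta.
rewrite !big_split/= sum_delta -/(quad M a).
under [X in _ + X + _]eq_bigr do rewrite -mulr_suml.
rewrite sum_delta -!mulr_sumr.
under eq_bigr do rewrite Msym.
by ring.
Qed.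

Lemma psd_diag_ge0 M i : psd M -> 0 <= M i i.
Proof.
by move=> /(_ (fun j => (j == i)%:R)); rewrite quad_delta.
Qed.

(* Induction on the number of nonzero diagonal entries, splitting off a
   rank-one term by a Schur complement. *)
Lemma psd_gram M : (forall i j, M i j = M j i) -> psd M ->
  exists s : seq (I -> R), forall i j, M i j = \sum_(c <- s) c i * c j.
Proof.
have [n] := ubnP #|[pred i | M i i != 0]|; elim: n M => // n IHn M Mn Msym Mpsd.
have [[k Mk]|M0] := pselect (exists k, M k k != 0); last first.
  exists [::] => i j; rewrite big_nil.
  have diag0 k : M k k = 0.
    by apply/eqP; apply: contrapT => /negP Mk; apply: M0; exists k.
  (* On [e_j + x e_i] the form is linear in [x] when the diagonal vanishes, so nonnegativity for
     both signs of [x] forces [M i j = 0]. *)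
  have pos (x : R) : 0 <= 2 * x * M i j.
    have := Mpsd (fun l => (l == j)%:R + x * (l == i)%:R).
    rewrite quad_shift// diag0 mulr0 addr0.
    by rewrite quad_delta diag0 add0r sum_delta.
  by have := pos (M i j); have := pos (- M i j); nra.
have Mk_gt0 : 0 < M k k by rewrite lt0r Mk psd_diag_ge0.
pose N i j := M i j - (M k k)^-1 * (M k i * M k j).
have Npsd : psd N.
  move=> a; rewrite quadB quadZ quad_rank1.
  pose t := \sum_j M k j * a j.
  (* This shift minimises the form of [M] along coordinate [k], and the minimum is the form of [N]
     at [a]. *)
  have := Mpsd (fun i => a i + (- t / M k k) * (i == k)%:R).
  rewrite quad_shift// -/t.
  suff -> : quad M a + 2 * (- t / M k k) * t + (- t / M k k) ^+ 2 * M k k =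
    quad M a - (M k k)^-1 * t ^+ 2 by [].
  by field.
have Nsym i j : N i j = N j i by rewrite /N Msym [M k j * _]mulrC.
(* Where [M i i = 0], the entry [N i i] is minus a nonnegative term, hence zero since [N] is psd;
   moreover [N k k = 0] while [M k k] is not. *)
have Nn : (#|[pred i | N i i != 0%R]| < n)%N.
  rewrite -ltnS; apply: leq_trans Mn; rewrite ltnS; apply: proper_card.
  apply/properP; split.
    apply/fintype.subsetP => i; rewrite !inE; apply: contra => /eqP Mi.
    have := psd_diag_ge0 i Npsd; rewrite /N Mi sub0r oppr_ge0 => Ni.
    rewrite oppr_eq0 eq_le Ni/= -expr2 mulr_ge0 ?sqr_ge0//.
    by rewrite invr_ge0 ltW.
  exists k; rewrite !inE// negbK /N subr_eq0; apply/eqP; by field.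
have [s Ns] := IHn N Nn Nsym Npsd.
exists ((fun i => M k i / Num.sqrt (M k k)) :: s) => i j.
rewrite big_cons -Ns /N.
have sq : Num.sqrt (M k k) ^+ 2 = M k k by rewrite sqr_sqrtr// ltW.
have sq0 : Num.sqrt (M k k) != 0 by rewrite gt_eqF// sqrtr_gt0.
by move: sq sq0; move: (Num.sqrt _) => r <- r0; field.
Qed.

(** Schur product theorem: multiplying [N] entrywise by a rank-one term [c i * c j] only rescales
    the argument of its form, and [M] is a sum of such terms. *)
Lemma psd_schur M N : (forall i j, M i j = M j i) -> psd M -> psd N ->
  psd (fun i j => M i j * N i j).
Proof.
move=> Msym Mpsd Npsd a; have [s Ms] := psd_gram Msym Mpsd.
rewrite (@eq_quad _ (fun i j => \sum_(c <- s) c i * c j * N i j)); last first.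
  by move=> i j; rewrite Ms mulr_suml.
by rewrite quad_sum; apply: sumr_ge0 => c _; rewrite quad_scale.
Qed.

Lemma psd_pow M n : (forall i j, M i j = M j i) -> psd M ->
  psd (fun i j => M i j ^+ n).
Proof.
move=> Msym Mpsd; elim: n => [a|n IHn].
  rewrite (@eq_quad _ (fun=> fun=> 1 * 1)); last by move=> *; rewrite mulr1.
  by rewrite (quad_rank1 (fun=> 1)) sqr_ge0.
move=> a; rewrite (@eq_quad _ (fun i j => M i j * M i j ^+ n)).
  exact: psd_schur.
by move=> i j; rewrite exprS.
Qed.

(** * Limits and exponentials of kernels *)

Lemma cvg_sumr (T J : Type) (F : set_system T) (FF : Filter F) (s : seq J)
    (f : T -> J -> R) l :
  (forall k, f t k @[t --> F] --> l k) ->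
  \sum_(k <- s) f t k @[t --> F] --> \sum_(k <- s) l k.
Proof.
move=> fl; elim: s => [|k s IHs].
  by rewrite big_nil; under eq_fun do rewrite big_nil; exact: cvg_cst.
rewrite big_cons; under eq_fun do rewrite big_cons.
exact: cvgD (fl k) IHs.
Qed.

Lemma cvg_quad (T : Type) (F : set_system T) (FF : Filter F)
    (M : T -> I -> I -> R) N a :
  (forall i j, M t i j @[t --> F] --> N i j) ->
  quad (M t) a @[t --> F] --> quad N a.
Proof.
move=> MN; apply: cvg_sumr => i; apply: cvg_sumr => j.
by apply: cvgMr_tmp; apply: cvgMr_tmp.
Qed.

(** The partial sums of the exponential series are nonnegative combinations of entrywise powers, and
    nonnegativity passes to the limit. *)
Lemma psd_expR M : (forall i j, M i j = M j i) -> psd M ->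
  psd (fun i j => expR (M i j)).
Proof.
move=> Msym Mpsd a.
have cvgM : quad (fun i j => series (exp_coeff (M i j)) n) a @[n --> \oo] -->
    quad (fun i j => expR (M i j)) a.
  by apply: cvg_quad => i j; exact: is_cvg_series_exp_coeff.
rewrite -(cvg_lim _ cvgM)//; apply: limr_ge; first exact: cvgP cvgM.
apply: nearW => n; rewrite quad_sum; apply: sumr_ge0 => k _.
rewrite (@eq_quad _ (fun i j => k`!%:R^-1 * M i j ^+ k)).
  by rewrite quadZ mulr_ge0 ?invr_ge0// psd_pow.
by move=> i j; rewrite /exp_coeff/= mulrC.
Qed.

(** One direction of Schoenberg's theorem: centering turns the conditionally negative kernel into a
    psd one, which is then exponentiated. *)
Lemma psd_expRN (K : I -> I -> R) (t : R) :
  (forall i j, K i j = K j i) -> (forall i, K i i = 0) ->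
  (forall a, \sum_i a i = 0 -> quad K a <= 0) -> 0 <= t ->
  psd (fun i j => expR (- (t * K i j))).
Proof.
move=> Ksym K0 Kneg t0 a.
have [[k _]|I0] := pselect (exists k : I, True); last first.
  by rewrite /quad big1// => i; case: I0; exists i.
(* Centering at k: [exp(-tK_ij) = exp(-tK_ki) exp(-tK_kj) exp(B_ij)]. *)
pose B i j := t * (K i k + K k j - K i j).
have Bsym i j : B i j = B j i.
  by rewrite /B (Ksym i k) (Ksym k j) (Ksym i j); ring.
have Bpsd : psd B.
  move=> b; rewrite quadZ; apply: mulr_ge0 => //.
  pose s := \sum_i b i; pose u := \sum_j K k j * b j.
  rewrite quadB.
  have -> : quad (fun i j => K i k + K k j) b = 2 * s * u.
    transitivity (\sum_i (K k i * b i * s + b i * u)).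
      apply: eq_bigr => i _; rewrite !mulr_sumr -big_split.
      by apply: eq_bigr => j _; rewrite (Ksym i k)/=; ring.
    by rewrite big_split/= -!mulr_suml -/s -/u; ring.
  (* Putting the mass [- s] at [k] makes the total weight zero; as [K k k = 0], the form of [K]
     there is [quad K b - 2 * s * u], and that of [B] at [b] is [- t] times it. *)
  have := Kneg (fun i => b i + (- s) * (i == k)%:R).
  rewrite big_split/= (sum_delta (fun=> - s)) subrr quad_shift// K0 -/u.
  by move=> /(_ erefl); lra.
rewrite (@eq_quad _ (fun i j => expR (- (t * K k i)) * expR (- (t * K k j)) *
    expR (B i j))); last first.
  by move=> i j; rewrite -!expRD /B (Ksym i k); congr expR; ring.
by rewrite (quad_scale (fun i => expR (- (t * K k i)))); exact: psd_expR.
Qed.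

Lemma quad_diag a : quad (fun i j => (j == i)%:R) a = \sum_i a i ^+ 2.
Proof.
apply: eq_bigr => i _; rewrite -[RHS](sum_delta (fun j => a i * a j) i).
by apply: eq_bigr => j _; ring.
Qed.

Lemma sum_sqr_gt0 a : ~ (forall i, a i = 0) -> 0 < \sum_i a i ^+ 2.
Proof.
move=> aN0; rewrite lt0r sumr_ge0 ?andbT => [|i _]; last exact: sqr_ge0.
rewrite psumr_eq0 => [|i _]; last exact: sqr_ge0.
apply/negP => /allP a20; apply: aN0 => i; apply/eqP.
by rewrite -sqrf_eq0; have := a20 i; rewrite mem_index_enum; exact.
Qed.

(** Diagonal entries stay 1 and off-diagonal ones decay to 0. This limit is the source of
    strictness. *)
Lemma cvg_quad_expRN (K : I -> I -> R) (a : I -> R) :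
  (forall i, K i i = 0) -> (forall i j, i != j -> 0 < K i j) ->
  quad (fun i j => expR (- (t * K i j))) a @[t --> +oo] --> \sum_i a i ^+ 2.
Proof.
move=> K0 Kpos.
rewrite -quad_diag; apply: cvg_quad => i j; have [->|ij] := eqVneq j i.
  by under eq_fun do rewrite K0 mulr0 oppr0 expR0; exact: cvg_cst.
apply: (@cvg_comp _ _ _ (fun t => t * K i j) (fun x => expR (- x)) _ +oo).
  by apply: gt0_cvgMly; rewrite ?Kpos// eq_sym.
exact: cvgr_expR.
Qed.

End psd_theory.

(** * Fractional powers of negative definite kernels *)

Section power_integral.
Context {R : realType}.
Local Notation mu := (@lebesgue_measure R).

Lemma integrable_expR_abs (b : R) : 0 < b ->
  mu.-integrable setT (EFin \o (fun v => expR (- (b * `|v|)))).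
Proof.
move=> b0.
have cf : continuous (fun v : R => expR (- (b * `|v|))).
  move=> v; apply: continuous_comp; last exact: continuous_expR.
  by apply: cvgN; apply: cvgMl_tmp; exact: norm_continuous.
have mf : measurable_fun setT (fun v : R => expR (- (b * `|v|))).
  exact: continuous_measurable_fun.
apply/integrableP; split; first exact/measurable_EFinP.
under eq_integral do rewrite /= ger0_norm ?expR_ge0//.
(* By evenness it suffices to integrate over the half-line, where the function is [b^-1] times the
   exponential density of rate [b]. *)
rewrite ge0_symfun_integralT//; last by move=> x /=; rewrite normrN.
have -> : [set v : R | 0 <= v] = `[0, +oo[%classic.
  by apply/seteqP; split => v; rewrite /= in_itv/= andbT.
rewrite lte_mul_pinfty//.
under eq_integral => v.
  rewrite inE/= in_itv/= andbT => v0.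
  rewrite ger0_norm//.
  have -> : expR (- (b * v)) = b^-1 * exponential_pdf b v.
    by rewrite exponential_pdfE// mulNr mulKf ?gt_eqF.
  rewrite EFinM; over.
apply: integrable_lty => //; apply: (@integrableZl _ _ _ mu) => //.
by apply: integrableS (integrable_exponential_pdf b0).
Qed.

(** With [s = expR v], this is the integrand [s^(-alpha-1) (1 - exp(-s x)) ds] of the Bernstein
    representation of [x^alpha]; in the variable [v], scaling [x] becomes a translation. *)
Definition power_kernel (alpha x v : R) : R :=
  expR (- (alpha * v)) * (1 - expR (- (expR v * x))).

Lemma power_kernel_ge0 alpha x v : 0 <= x -> 0 <= power_kernel alpha x v.
Proof.
move=> x0; rewrite mulr_ge0 ?expR_ge0// subr_ge0 expR_le1 oppr_le0.
by rewrite mulr_ge0 ?expR_ge0.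
Qed.

Lemma power_kernel_shift alpha u v :
  power_kernel alpha (expR u) v =
  expR (alpha * u) * power_kernel alpha 1 (v + u).
Proof.
rewrite /power_kernel mulrA -!expRD mulr1.
by congr (expR _ * _); ring.
Qed.

Lemma continuous_power_kernel alpha x : continuous (power_kernel alpha x).
Proof.
move=> v; apply: cvgM.
  apply: (@continuous_comp _ _ _ (fun v => - (alpha * v)) expR).
    by apply: cvgN; apply: cvgMl_tmp.
  exact: continuous_expR.
apply: cvgB; first exact: cvg_cst.
apply: (@continuous_comp _ _ _ (fun v => - (expR v * x)) expR).
  by apply: cvgN; apply: cvgMr_tmp; exact: continuous_expR.
exact: continuous_expR.
Qed.

Lemma integrable_power_kernel1 alpha : 0 < alpha < 1 ->
  mu.-integrable setT (EFin \o power_kernel alpha 1).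
Proof.
(* The decay rate is [alpha] for [v >= 0], where the second factor is at most 1, and [1 - alpha] for
   [v <= 0], where [1 - exp(-y) <= y] with [y = expR v]. *)
move=> /andP[alpha0 alpha1]; pose b := Num.min alpha (1 - alpha).
have b0 : 0 < b by rewrite lt_min alpha0 subr_gt0.
apply: le_integrable (integrable_expR_abs b0) => //.
  apply/measurable_EFinP; apply: continuous_measurable_fun.
  exact: continuous_power_kernel.
move=> v _; rewrite /= lee_fin ger0_norm ?power_kernel_ge0//.
rewrite ger0_norm ?expR_ge0//.
have [v0|/ltW v0] := leP 0 v.
  apply: (@le_trans _ _ (expR (- (alpha * v)))).
    by rewrite ler_piMr ?expR_ge0// lerBlDr lerDl expR_ge0.
  rewrite ler_expR lerN2 ger0_norm//.
  by rewrite ler_wpM2r// ge_min lexx.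
apply: (@le_trans _ _ (expR (- (alpha * v)) * expR v)).
  rewrite ler_pM2l ?expR_gt0// mulr1.
  by have := expR_ge1Dx (- expR v); lra.
rewrite -expRD ler_expR ler0_norm// mulrN opprK.
have -> : - (alpha * v) + v = (1 - alpha) * v by ring.
by rewrite ler_wnM2r// ge_min lexx orbT.
Qed.

Lemma integral_power_kernel_shift alpha u :
  (\int[mu]_v (power_kernel alpha 1 (v + u))%:E =
   \int[mu]_v (power_kernel alpha 1 v)%:E)%E.
Proof.
have dE : derive1 (fun v : R => v + u) = cst 1.
  apply/funext => v; rewrite /= derive1E deriveD// derive_id derive_cst.
  by rewrite addr0.
rewrite [RHS](@increasing_ge0_integration_by_substitutionT _ (fun v => v + u)).
- by apply: eq_integral => v _; rewrite dE /= !fctE mulr1.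
- by move=> x y; rewrite ltrD2r.
- by rewrite dE; exact: cst_continuous.
- by rewrite dE; exact: is_cvg_cst.
- by rewrite dE; exact: is_cvg_cst.
- by move=> x; apply: derivableD.
- exact: cvg_addrr_Ny.
- exact: cvg_addrr.
- exact: continuous_power_kernel.
- by move=> v; exact: power_kernel_ge0.
Qed.

Lemma ge0_integral_power_kernel alpha x : 0 < alpha < 1 -> 0 <= x ->
  (\int[mu]_v (power_kernel alpha x v)%:E =
   (x `^ alpha)%:E * \int[mu]_v (power_kernel alpha 1 v)%:E)%E.
Proof.
move=> alpha01; have /andP[alpha0 _] := alpha01.
(* Translation by [ln x] requires [x > 0]; at [x = 0] both sides vanish. *)
rewrite le_eqVlt => /predU1P[<-|x0].
  rewrite powR0 ?gt_eqF// mul0e integral0_eq// => v _.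
  by rewrite /power_kernel mulr0 oppr0 expR0 subrr mulr0.
have -> : x `^ alpha = expR (alpha * ln x) by rewrite mulrC expRM lnK.
rewrite -(integral_power_kernel_shift alpha (ln x)).
under eq_integral do rewrite -{1}(lnK x0) power_kernel_shift EFinM.
rewrite ge0_integralZl//.
- apply/measurable_EFinP; apply: continuous_measurable_fun => v.
  apply: (@continuous_comp _ _ _ (fun v => v + ln x) (power_kernel alpha 1)).
    by apply: cvgD => //; exact: cvg_cst.
  exact: continuous_power_kernel.
- by move=> v _; rewrite lee_fin power_kernel_ge0.
Qed.

Lemma integrable_power_kernel alpha x : 0 < alpha < 1 -> 0 <= x ->
  mu.-integrable setT (EFin \o power_kernel alpha x).
Proof.
move=> alpha01 x0; apply/integrableP; split.
  apply/measurable_EFinP; apply: continuous_measurable_fun.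
  exact: continuous_power_kernel.
under eq_integral do rewrite /= ger0_norm ?power_kernel_ge0//.
rewrite ge0_integral_power_kernel// lte_mul_pinfty// ?lee_fin ?powR_ge0//.
by apply: integrable_lty => //; exact: integrable_power_kernel1.
Qed.

Lemma Rintegral_power_kernel alpha x : 0 < alpha < 1 -> 0 <= x ->
  \int[mu]_v power_kernel alpha x v =
  x `^ alpha * \int[mu]_v power_kernel alpha 1 v.
Proof.
move=> alpha01 x0; rewrite /Rintegral ge0_integral_power_kernel// fineM//.
by apply: integrable_fin_num => //; exact: integrable_power_kernel1.
Qed.

(** * Integrating quadratic forms over the parameter *)

Lemma integrable_sumr (J : Type) (s : seq J) (f : J -> R -> R) :
  (forall k, mu.-integrable setT (EFin \o f k)) ->
  mu.-integrable setT (EFin \o (fun v => \sum_(k <- s) f k v)).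
Proof.
move=> fi; rewrite (_ : _ \o _ = fun v => (\sum_(k <- s) (f k v)%:E)%E).
  by apply: integrable_sum => // k _; exact: fi.
by apply/funext => v; rewrite /= sumEFin.
Qed.

Lemma Rintegral_sum (J : Type) (s : seq J) (f : J -> R -> R) :
  (forall k, mu.-integrable setT (EFin \o f k)) ->
  \int[mu]_v (\sum_(k <- s) f k v) = \sum_(k <- s) \int[mu]_v f k v.
Proof.
move=> fi; elim: s => [|k s IHs].
  rewrite big_nil; under eq_Rintegral do rewrite big_nil.
  by rewrite Rintegral_cst// mul0r.
rewrite big_cons; under eq_Rintegral do rewrite big_cons.
by rewrite RintegralD// ?IHs//; exact: integrable_sumr.
Qed.

(** The constant 1 in [power_kernel] contributes the square of the total weight, which is zero. *)
Lemma quad_power_kernel (I : finType) (K : I -> I -> R) a alpha v :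
  \sum_i a i = 0 ->
  quad (fun i j => power_kernel alpha (K i j) v) a =
  - (expR (- (alpha * v)) * quad (fun i j => expR (- (expR v * K i j))) a).
Proof.
move=> a0; rewrite quadZ quadB.
rewrite (@eq_quad _ _ (fun=> fun=> 1) (fun=> fun=> 1 * 1)).
  rewrite (quad_rank1 (fun=> 1)); under eq_bigr do rewrite mul1r.
  by rewrite a0; ring.
by move=> *; rewrite mulr1.
Qed.

Lemma integrable_quad (I : finType) (f : I -> I -> R -> R) (a : I -> R) :
  (forall i j, mu.-integrable setT (EFin \o f i j)) ->
  mu.-integrable setT (EFin \o (fun v => quad (fun i j => f i j v) a)).
Proof.
move=> fi; apply: integrable_sumr => i; apply: integrable_sumr => j.
apply: eq_integrable (integrableZl _ (a i * a j) (fi i j)) => // v _.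
by rewrite /= -EFinM; congr EFin; ring.
Qed.

Lemma Rintegral_quad (I : finType) (f : I -> I -> R -> R) (a : I -> R) :
  (forall i j, mu.-integrable setT (EFin \o f i j)) ->
  \int[mu]_v quad (fun i j => f i j v) a =
  quad (fun i j => \int[mu]_v f i j v) a.
Proof.
move=> fi.
have fai i j : mu.-integrable setT (EFin \o (fun v => f i j v * (a i * a j))).
  apply: eq_integrable (integrableZl _ (a i * a j) (fi i j)) => // v _.
  by rewrite /= -EFinM; congr EFin; ring.
under eq_Rintegral => v _.
  rewrite /quad; under eq_bigr do under eq_bigr do rewrite -mulrA.
  over.
rewrite Rintegral_sum => [|i]; last exact: integrable_sumr.
apply: eq_bigr => i _; rewrite Rintegral_sum//.
by apply: eq_bigr => j _; rewrite RintegralZr// mulrA.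
Qed.

Lemma Rintegral_gt0 (h : R -> R) (c v0 : R) :
  mu.-integrable setT (EFin \o h) -> (forall v, 0 <= h v) -> 0 < c ->
  (forall v, v0 <= v <= v0 + 1 -> c <= h v) ->
  0 < \int[mu]_v h v.
Proof.
move=> hi h0 c0 hc.
have indi : mu.-integrable setT (EFin \o \1_`[v0, v0 + 1]).
  exact: integrable_indic_itv.
apply: (@lt_le_trans _ _ (\int[mu]_v (c * \1_`[v0, v0 + 1] v))).
  rewrite RintegralZl// mulr_gt0// /Rintegral integral_indic// setIT.
  rewrite /= lebesgue_measure_itv/= lte_fin ltrDl ltr01/=.
  by rewrite addrAC subrr add0r.
apply: le_Rintegral => //; first exact: (integrableZl measurableT c indi).
move=> v _; rewrite indicE; case: (boolP (v \in _)) => [|_]; last first.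
  by rewrite mulr0.
by rewrite inE/= in_itv/= mulr1 => /hc.
Qed.

Lemma quad_powR_lt0 (I : finType) (K : I -> I -> R) (alpha : R) (a : I -> R) :
  (forall i j, K i j = K j i) -> (forall i, K i i = 0) ->
  (forall i j, i != j -> 0 < K i j) ->
  (forall b, \sum_i b i = 0 -> quad K b <= 0) ->
  0 < alpha < 1 -> \sum_i a i = 0 -> ~ (forall i, a i = 0) ->
  quad (fun i j => K i j `^ alpha) a < 0.
Proof.
move=> Ksym K0 Kpos Kneg alpha01 a0 aN0; have /andP[alpha0 _] := alpha01.
have K_ge0 i j : 0 <= K i j.
  by have [->|/Kpos/ltW//] := eqVneq i j; rewrite K0.
pose E v := quad (fun i j => expR (- (expR v * K i j))) a.
pose c0 := \int[mu]_v power_kernel alpha 1 v.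
have Ki i j : mu.-integrable setT (EFin \o power_kernel alpha (K i j)).
  exact: integrable_power_kernel.
have EI : mu.-integrable setT (EFin \o (fun v => expR (- (alpha * v)) * E v)).
  apply: eq_integrable (integrableN (integrable_quad a Ki)) => // v _.
  by rewrite /= quad_power_kernel// opprK.
have : quad (fun i j => K i j `^ alpha) a * c0 =
    - \int[mu]_v (expR (- (alpha * v)) * E v).
  transitivity (quad (fun i j => \int[mu]_v power_kernel alpha (K i j) v) a).
    rewrite mulrC -quadZ; apply: eq_quad => i j.
    by rewrite Rintegral_power_kernel// mulrC.
  rewrite -Rintegral_quad//.
  under eq_Rintegral do rewrite quad_power_kernel// -mulN1r.
  by rewrite RintegralZl// mulN1r.
(* A nonnegative form times [c0 >= 0] cannot equal the negative of a positive integral. *)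
suff : 0 < \int[mu]_v (expR (- (alpha * v)) * E v).
  have : 0 <= c0.
    by apply: Rintegral_ge0 => v _; rewrite power_kernel_ge0.
  move=> c00 I0 Q; rewrite ltNge; apply/negP => Q0.
  by have := mulr_ge0 Q0 c00; rewrite Q oppr_ge0 leNgt I0.
have s0 := sum_sqr_gt0 aN0.
set s := \sum_i a i ^+ 2 in s0.
have [M [_ Mlim]] : \forall t \near +oo,
    s / 2 <= quad (fun i j => expR (- (t * K i j))) a.
  apply: (cvgr_ge _ (cvg_quad_expRN (a := a) K0 Kpos)).
  by rewrite -/s gtr_pMr// invf_lt1// ltr1n.
(* Chosen so that [expR v > M] for all [v >= v0]; there [E v] is at least half its limit [s]. On the
   unit interval from [v0] the other factor is smallest at [v0 + 1]. *)
pose v0 := ln (`|M| + 1).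
have Epos v : 0 <= E v by apply: psd_expRN => //; exact: expR_ge0.
apply: (@Rintegral_gt0 _ (expR (- (alpha * (v0 + 1))) * (s / 2)) v0) => //.
- by move=> v; rewrite mulr_ge0 ?expR_ge0.
- by rewrite mulr_gt0 ?expR_gt0// divr_gt0.
move=> v /andP[v0v vv0]; apply: ler_pM; rewrite ?expR_ge0//.
- by rewrite divr_ge0// ltW.
- by rewrite ler_expR lerN2 ler_pM2l.
apply: Mlim; apply: (@lt_le_trans _ _ (`|M| + 1)).
  by rewrite ltr_pwDr// ler_norm.
have M1 : 0 < `|M| + 1 by rewrite ltr_wpDl.
by rewrite -(lnK M1) ler_expR.
Qed.

End power_integral.

(** * Negative type and simplex gaps *)

Section reindexing.
Context {R : realType}.

Lemma sum_fiber (I J : finType) (h : J -> I) (F : I -> R) (c : J -> R) :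
  \sum_j F (h j) * c j = \sum_i F i * \sum_(j | h j == i) c j.
Proof.
rewrite (partition_big h xpredT)//=; apply: eq_bigr => i _.
by rewrite mulr_sumr; apply: eq_bigr => j /eqP ->.
Qed.

(** Pulling a kernel back along [h] amounts to pushing the weights forward; this merges repeated
    vertices of a simplex. *)
Lemma quad_fiber (I J : finType) (h : J -> I) (M : I -> I -> R) (c : J -> R) :
  quad (fun j k => M (h j) (h k)) c =
  quad M (fun i => \sum_(j | h j == i) c j).
Proof.
pose G i := \sum_k M i (h k) * c k.
transitivity (\sum_j G (h j) * c j).
  apply: eq_bigr => j _; rewrite mulr_suml.
  by apply: eq_bigr => k _; rewrite mulrAC.
rewrite sum_fiber; apply: eq_bigr => i _.
by rewrite /G sum_fiber mulr_suml; apply: eq_bigr => k _; rewrite mulrAC.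
Qed.

Lemma quad_sum_type (I J : finType) (M : I + J -> I + J -> R)
    (c : I + J -> R) : (forall u v, M u v = M v u) ->
  quad M c =
  quad (fun i j => M (inl i) (inl j)) (fun i => c (inl i)) +
  quad (fun i j => M (inr i) (inr j)) (fun i => c (inr i)) +
  2 * \sum_i \sum_j M (inl i) (inr j) * c (inl i) * c (inr j).
Proof.
move=> Msym; rewrite /quad big_sumType/=.
under eq_bigr do rewrite big_sumType/=.
under [X in _ + X]eq_bigr do rewrite big_sumType/=.
rewrite !big_split/=.
rewrite [X in _ + (X + _)](_ : _ =
    \sum_i \sum_j M (inl i) (inr j) * c (inl i) * c (inr j)); first by ring.
rewrite exchange_big; apply: eq_bigr => i _; apply: eq_bigr => j _.
by rewrite Msym mulrAC.
Qed.

Lemma sum_symmetric (n : nat) (F : 'I_n -> 'I_n -> R) :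
  (forall i j, F i j = F j i) -> (forall i, F i i = 0) ->
  \sum_i \sum_j F i j = 2 * \sum_(i < n) \sum_(j < n | (i < j)%N) F i j.
Proof.
move=> Fsym F0.
transitivity (\sum_(i < n) (\sum_(j < n | (i < j)%N) F i j +
    \sum_(j < n | (j < i)%N) F i j)).
  apply: eq_bigr => i _; rewrite (bigID (fun j : 'I_n => (i < j)%N))/=.
  congr (_ + _); rewrite (bigD1 i) ?ltnn//= F0 add0r.
  by apply: eq_bigl => j; rewrite -leqNgt ltn_neqAle andbC.
rewrite big_split/= mulr_natl mulr2n; congr (_ + _).
rewrite (exchange_big_dep xpredT)//=; apply: eq_bigr => i _.
by apply: eq_bigr => j _; rewrite Fsym.
Qed.

End reindexing.

(** * Strict negative type under change of exponent and of space *)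

Section negative_type_theory.
Context {R : realType}.
Implicit Types (X : metricType R) (p q : R).

Lemma mdist_pow_sym X p (x y : X) : mdist_pow p x y = mdist_pow p y x.
Proof. by rewrite /mdist_pow metric_sym [x == y]eq_sym. Qed.

Lemma mdist_powxx X p (x : X) : mdist_pow p x x = 0.
Proof.
by rewrite /mdist_pow eqxx mdistxx; case: eqVneq => // p0; rewrite powR0.
Qed.

Lemma strict_negative_typeP X p :
  (forall n (z : 'I_n -> X) (a : 'I_n -> R),
    injective z -> \sum_(i < n) a i = 0 -> ~ (forall i, a i = 0) ->
    quad (fun i j => mdist_pow p (z i) (z j)) a < 0) ->
  strict_negative_type X p.
Proof.
move=> H; split=> [n z a zI a0|n z a]; last exact: H.
have [aE|aN] := pselect (forall i, a i = 0); last by apply/ltW; exact: H.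
by rewrite big1// => i _; rewrite big1// => j _; rewrite !aE mulr0.
Qed.

(** On distinct points the kernel is all ones minus the identity, so on zero-sum weights its form is
    minus the sum of squares. *)
Lemma strict_negative_type0 X : strict_negative_type X 0.
Proof.
apply: strict_negative_typeP => n z a zI a0 aN0.
rewrite (@eq_quad _ _ _ (fun i j => 1 * 1 - (j == i)%:R)); last first.
  move=> i j; rewrite /mdist_pow eqxx mulr1 (inj_eq zI) [j == i]eq_sym.
  by case: eqP; rewrite ?subrr ?subr0.
rewrite quadB (quad_rank1 (fun=> 1)).
under eq_bigr do rewrite mul1r.
rewrite a0 expr0n/= sub0r oppr_lt0 quad_diag.
by apply: sum_sqr_gt0.
Qed.

Lemma strict_negative_type_le X p q : 0 <= p <= q ->
  strict_negative_type X q -> strict_negative_type X p.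
Proof.
move=> /andP[]; rewrite le_eqVlt => /predU1P[<- _ _|p0].
  exact: strict_negative_type0.
rewrite le_eqVlt => /predU1P[->//|pq] [qneg _].
have q0 := lt_trans p0 pq.
apply: strict_negative_typeP => n z a zI a0 aN0.
rewrite (@eq_quad _ _ _ (fun i j => mdist_pow q (z i) (z j) `^ (p / q))).
  apply: quad_powR_lt0 => //.
  - by move=> i j; exact: mdist_pow_sym.
  - by move=> i; exact: mdist_powxx.
  - move=> i j ij; rewrite /mdist_pow gt_eqF// powR_gt0// mdist_gt0.
    by rewrite (inj_eq zI).
  - by move=> b b0; exact: qneg.
  - by rewrite divr_gt0// ltr_pdivrMr// mul1r.
move=> i j; rewrite /mdist_pow !gt_eqF// -powRrM; congr (_ `^ _).
by rewrite mulrCA divff ?gt_eqF// mulr1.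
Qed.

Lemma strict_negative_type_inj X (Y : metricType R) p (g : Y -> X) :
  (forall x y, mdist (g x) (g y) = mdist x y) ->
  strict_negative_type X p -> strict_negative_type Y p.
Proof.
move=> gE [_ Xp]; apply: strict_negative_typeP => n z a zI a0 aN0.
have gI : injective g.
  by move=> x y gxy; apply: mdist_positivity; rewrite -gE gxy mdistxx.
rewrite (@eq_quad _ _ _ (fun i j => mdist_pow p (g (z i)) (g (z j)))).
  by apply: Xp => //; exact: inj_comp.
by move=> i j; rewrite /mdist_pow gE (inj_eq gI).
Qed.

(** Every space has 0-negative type. Hence any exponent at or above the roundness is nonnegative. *)
Lemma generalized_roundness_ge0 X : (0 <= generalized_roundness X)%E.
Proof.
apply: ereal_sup_ubound; exists 0 => //; split => //.
by have [] := strict_negative_type0 X.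
Qed.

(** * The simplex gap as a quadratic form *)

Section simplex.
Context {X : metricType R} (p : R) (D : signed_simplex X).

Let vtx (u : 'I_(ss_s D) + 'I_(ss_t D)) : X :=
  match u with inl j => ss_x j | inr i => ss_y i end.

(** With this sign the balance condition says that the total weight is zero, and the weight
    collected at a point is [x_weight] minus [y_weight]. *)
Let wgt (u : 'I_(ss_s D) + 'I_(ss_t D)) : R :=
  match u with inl j => ss_m j | inr i => - ss_n i end.

Let quad_gap :
  quad (fun u v => mdist_pow p (vtx u) (vtx v)) wgt = - 2 * simplex_gap p D.
Proof.
rewrite quad_sum_type; last by move=> u v; exact: mdist_pow_sym.
rewrite /quad !sum_symmetric/=; try by
  [move=> i j; rewrite mdist_pow_sym mulrAC |
   move=> i; rewrite mdist_powxx !mul0r].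
rewrite /simplex_gap.
set A := \sum_(j < ss_s D) _; set B := \sum_(j1 < ss_s D) _.
set C := \sum_(i1 < ss_t D) _.
have -> : \sum_(i < ss_s D) \sum_(j < ss_s D | (i < j)%N)
    mdist_pow p (ss_x i) (ss_x j) * ss_m i * ss_m j = B.
  by apply: eq_bigr => i _; apply: eq_bigr => j _; ring.
have -> : \sum_(i < ss_t D) \sum_(j < ss_t D | (i < j)%N)
    mdist_pow p (ss_y i) (ss_y j) * - ss_n i * - ss_n j = C.
  by apply: eq_bigr => i _; apply: eq_bigr => j _; ring.
have -> : \sum_(i < ss_s D) \sum_(j < ss_t D)
    mdist_pow p (ss_x i) (ss_y j) * ss_m i * - ss_n j = - A.
  rewrite -sumrN; apply: eq_bigr => i _; rewrite -sumrN.
  by apply: eq_bigr => j _; ring.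
by ring.
Qed.

Lemma simplex_gap_gt0 :
  strict_negative_type X p -> ~ degenerate D -> 0 < simplex_gap p D.
Proof.
(* Negative type is stated for distinct points, so [z] enumerates the vertices without repetition
   and [h] sends each vertex index to its place in that list. *)
move=> [_ Xp] Dnd; pose s := undup (codom vtx).
have vtxs u : (index (vtx u) s < size s)%N.
  by rewrite index_mem mem_undup codom_f.
pose h u := Ordinal (vtxs u); pose z := tnth (in_tuple s).
have zh u : z (h u) = vtx u.
  by rewrite /z (tnth_nth (vtx u))/= nth_index// -index_mem.
have zI : injective z by apply/tuple_uniqP; exact: undup_uniq.
pose a i := \sum_(u | h u == i) wgt u.
have : quad (fun i j => mdist_pow p (z i) (z j)) a < 0.
  apply: Xp => //.
    have := sum_fiber h (fun=> 1) wgt; under eq_bigr do rewrite mul1r.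
    under [RHS]eq_bigr do rewrite mul1r.
    by move=> <-; rewrite big_sumType/= sumrN ss_balance subrr.
  (* If all collected weights vanished, [x_weight] and [y_weight] would agree on the support, making
     [D] degenerate. *)
  move=> a0; apply: Dnd => x xD; apply/eqP; rewrite -subr_eq0; apply/eqP.
  have [u xu] : exists u, x = vtx u.
    by case: xD => -[i _ <-]; [exists (inl i)|exists (inr i)].
  rewrite -[RHS](a0 (h u)) /a big_sumType/= sumrN.
  by congr (_ - _); apply: eq_bigl => j; rewrite xu -(inj_eq zI) !zh.
rewrite -quad_fiber.
rewrite (@eq_quad _ _ _ (fun u v => mdist_pow p (vtx u) (vtx v))).
  by rewrite quad_gap; lra.
by move=> u v; rewrite !zh.
Qed.

End simplex.
End negative_type_theory.

Theorem theorem3p24 (R : realType) (Y : metricType R) (w : R)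
  (Y_roundness : generalized_roundness Y = w%:E)
  (X : metricType R) (q : R) (w_le_q : w <= q)
  (X_strict : strict_negative_type X q)
  (Z : set Y)
  (Z_equality : exists p : R,
     w <= p <= q /\ nontrivial_polygonal_equality (set_type Z) p) :
  ~ isometric X (set_type Z).
Proof.
move=> [f [[g fK gK] fE]].
have [p [/andP[wp pq] [D [Dnd D0]]]] := Z_equality.
have w0 : 0 <= w by rewrite -lee_fin -Y_roundness generalized_roundness_ge0.
have p0q : 0 <= p <= q by rewrite (le_trans w0 wp).
have gE x y : mdist (g x) (g y) = mdist x y by rewrite -fE !gK.
(* Strictness descends from [q] to [p] on [X], then moves to [Z] along the inverse isometry [g];
   there the zero gap of [D] is impossible. *)
have Zp := strict_negative_type_inj gE (strict_negative_type_le p0q X_strict).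
by have := simplex_gap_gt0 Zp Dnd; rewrite D0 ltxx.
Qed.
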